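(* Suppose $L,M>0$ and that the mirror-prox sliding (MPS) method, described in the context, is run with the parameters $$\gamma_k=\frac{2}{k+1},\qquad \beta_k=\frac{2L}{k},\qquad T_k=\left\lceil\frac{kM}{L}\right\rceil,\qquad \eta_k^t=\beta_k(t-1)+\frac{LT_k}{k}.$$ Let $\Omega_{z_0}:=\sup_{z\in Z}V(z_0,z)$. Then, in order to compute an approximate solution $\overline z_N$ such that $\sup_{z\in Z}Q(\overline z_N,z)\le\varepsilon$, the number of evaluations of the gradient $\nabla G(\cdot)$ and the number of evaluations of the operator $H(\cdot)$ performed by the method are bounded by $$\mathcal O\left(\sqrt{\frac{L\Omega_{z_0}}{\varepsilon}}\right)\quad\text{and}\quad \mathcal O\left(\frac{M\Omega_{z_0}}{\varepsilon}+\sqrt{\frac{L\Omega_{z_0}}{\varepsilon}}\right),$$ respectively. That is, there is a universal constant $C$ such that for every $0<\varepsilon\le L\Omega_{z_0}$ there is a number $N$ of outer iterations for which the output satisfies $\sup_{z\in Z}Q(\overline z_N,z)\le\varepsilon$, while the total numbers of evaluations of $\nabla G$ and of $H$ in the $N$ outer iterations are at most $C\sqrt{L\Omega_{z_0}/\varepsilon}$ and $C\left(M\Omega_{z_0}/\varepsilon+\sqrt{L\Omega_{z_0}/\varepsilon}\right)$, respectively.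
   Context: Problem setting. $Z\subseteq\mathbb R^n$ is a nonempty compact convex set, $\|\cdot\|$ is a norm on $\mathbb R^n$ with dual norm $\|\cdot\|_*$. $G:\mathbb R^n\to\mathbb R$ is convex and continuously differentiable, $H:\mathbb R^n\to\mathbb R^n$ is monotone, i.e. $\langle H(u)-H(v),u-v\rangle\ge0$ for all $u,v$, and $$\|\nabla G(w)-\nabla G(v)\|_*\le L\|w-v\|,\qquad \|H(w)-H(v)\|_*\le M\|w-v\|,\qquad\forall w,v\in Z.$$ $J$ is a (simple) real-valued convex function on $Z$, simple meaning that the minimization subproblems below have solutions. The problem is to find $z^*\in Z$ with $\langle \nabla G(z)+H(z),z^*-z\rangle+J(z^* )-J(z)\le0$ for all $z\in Z$. Accuracy is measured by $$Q(\tilde z,z):=G(\tilde z)-G(z)+\langle H(z),\tilde z-z\rangle+J(\tilde z)-J(z).$$ Prox-function. $\pi$ is continuously differentiable on an open set containing $Z$ and strongly convex with respect to $\|\cdot\|$ with parameter $1$, and $V(z,u):=\pi(u)-\pi(z)-\langle\nabla\pi(z),u-z\rangle$ for $z,u\in Z$; thus $V(z,u)\ge\frac12\|z-u\|^2$. MPS method. Inputs: $z_0\in Z$, the number $N\ge1$ of outer iterations, and parameters $\gamma_k$, $\beta_k$, positive integers $T_k$, and $\eta_k^t$ ($1\le k\le N$, $1\le t\le T_k$). Set $\overline z_0=z_0$. For $k=1,\dots,N$: (1) set $\underline z_k=(1-\gamma_k)\overline z_{k-1}+\gamma_k z_{k-1}$ and $z_k^0=z_{k-1}$; (2) for $t=1,\dots,T_k$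 compute $$\tilde z_k^t\in\operatorname*{argmin}_{z\in Z}\ \langle\nabla G(\underline z_k)+H(z_k^{t-1}),z\rangle+J(z)+\beta_kV(z_{k-1},z)+\eta_k^tV(z_k^{t-1},z),$$ $$z_k^t\in\operatorname*{argmin}_{z\in Z}\ \langle\nabla G(\underline z_k)+H(\tilde z_k^t),z\rangle+J(z)+\beta_kV(z_{k-1},z)+\eta_k^tV(z_k^{t-1},z);$$ (3) set $z_k=z_k^{T_k}$, $\tilde z_k=\frac1{T_k}\sum_{t=1}^{T_k}\tilde z_k^t$, and $\overline z_k=(1-\gamma_k)\overline z_{k-1}+\gamma_k\tilde z_k$. Output $\overline z_N$. Outer iteration $k$ uses one evaluation of $\nabla G$ (at $\underline z_k$) and $2T_k$ evaluations of $H$. *)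

(* Defs.v *)
From mathcomp Require Import all_boot all_order all_algebra.
From mathcomp Require Import all_classical all_reals all_analysis.

Set Implicit Arguments.
Unset Strict Implicit.
Unset Printing Implicit Defensive.

Import Order.TTheory GRing.Theory Num.Theory.
Import numFieldNormedType.Exports.

Local Open Scope classical_set_scope.
Local Open Scope ring_scope.

Section Euclidean.
Context {R : realType} {n : nat}.
Implicit Types (u v x y : 'rV[R]_n) (f : 'rV[R]_n -> R) (nrm : 'rV[R]_n -> R).

Definition inner u v : R := \sum_(i < n) u 0 i * v 0 i.

(* The canonical norm of 'rV[R]_n is the sup norm; it is only used for the
   topology, all norms on R^n being equivalent. *)
Definition is_norm nrm : Prop :=
  [/\ forall x, nrm x = 0 -> x = 0,
      forall (a : R) x, nrm (a *: x) = `|a| * nrm x &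
      forall x y, nrm (x + y) <= nrm x + nrm y].

(* The set is bounded because nrm is equivalent to the sup norm. *)
Definition dual_norm nrm y : R := sup [set inner y x | x in [set x | nrm x <= 1]].

Definition grad f x : 'rV[R]_n := \row_(i < n) 'D_(delta_mx 0 i) f x.

Definition continuously_differentiable_on (U : set 'rV[R]_n) f : Prop :=
  forall x, U x -> differentiable f x /\ {for x, continuous (grad f)}.

Definition strongly_convex_on (Z : set 'rV[R]_n) nrm (mu : R) f : Prop :=
  forall x y (t : R), Z x -> Z y -> 0 <= t -> t <= 1 ->
    f (t *: x + (1 - t) *: y) <=
      t * f x + (1 - t) * f y - mu / 2 * t * (1 - t) * nrm (x - y) ^+ 2.

Definition lipschitz_on_wrt (Z : set 'rV[R]_n) nrm (K : R)
    (F : 'rV[R]_n -> 'rV[R]_n) : Prop :=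
  forall w v, Z w -> Z v -> dual_norm nrm (F w - F v) <= K * nrm (w - v).

Definition monotone_operator (H : 'rV[R]_n -> 'rV[R]_n) : Prop :=
  forall u v, 0 <= inner (H u - H v) (u - v).

Definition argmin (Z : set 'rV[R]_n) f : set 'rV[R]_n :=
  [set x | Z x /\ forall y, Z y -> f x <= f y].

Definition bregman (pi : 'rV[R]_n -> R) z u : R :=
  pi u - pi z - inner (grad pi z) (u - z).

(* pi is a prox-function; V(z0, .) is then continuous on the compact set Z,
   so that this real supremum is the usual one. *)
Definition Omega (Z : set 'rV[R]_n) pi z0 : R :=
  sup [set bregman pi z0 z | z in Z].

Definition gap (G : 'rV[R]_n -> R) (H : 'rV[R]_n -> 'rV[R]_n) (J : 'rV[R]_n -> R)
    (zt z : 'rV[R]_n) : R :=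
  G zt - G z + inner (H z) (zt - z) + J zt - J z.

Definition prox_objective (J pi : 'rV[R]_n -> R) (g : 'rV[R]_n) (beta eta : R)
    (c d z : 'rV[R]_n) : R :=
  inner g z + J z + beta * bregman pi c z + eta * bregman pi d z.

Definition simple (Z : set 'rV[R]_n) (J pi : 'rV[R]_n -> R) : Prop :=
  forall (g : 'rV[R]_n) (beta eta : R) (c d : 'rV[R]_n),
    0 < beta -> 0 < eta -> Z c -> Z d ->
    argmin Z (prox_objective J pi g beta eta c d) !=set0.

End Euclidean.

Section MirrorProxSliding.
Context {R : realType} {n : nat}.

Record mps_params := MPSParams {
  mps_gamma : nat -> R;
  mps_beta : nat -> R;
  mps_T : nat -> nat;
  mps_eta : nat -> nat -> R   (* mps_eta k t is eta_k^t *)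
}.

(* The sequences z_k, \overline z_k, z_k^t and \tilde z_k^t; the last two take
   k first, then t. *)
Record mps_iterates := MPSIterates {
  mps_z : nat -> 'rV[R]_n;
  mps_zbar : nat -> 'rV[R]_n;
  mps_zin : nat -> nat -> 'rV[R]_n;
  mps_ztilde : nat -> nat -> 'rV[R]_n
}.

Definition mps_run (Z : set 'rV[R]_n) (G : 'rV[R]_n -> R)
    (H : 'rV[R]_n -> 'rV[R]_n) (J pi : 'rV[R]_n -> R) (z0 : 'rV[R]_n)
    (p : mps_params) (N : nat) (s : mps_iterates) : Prop :=
  [/\ mps_z s 0 = z0,
      mps_zbar s 0 = z0 &
      forall k : nat, (1 <= k <= N)%N ->
        let gamma := mps_gamma p k in
        let T := mps_T p k in
        let zprev := mps_z s k.-1 in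
        let zbarprev := mps_zbar s k.-1 in
        let zunder := (1 - gamma) *: zbarprev + gamma *: zprev in
        let zavg := T%:R^-1 *: \sum_(1 <= t < T.+1) mps_ztilde s k t in
        let obj t g := prox_objective J pi g (mps_beta p k) (mps_eta p k t)
                         zprev (mps_zin s k t.-1) in
        [/\ mps_zin s k 0 = zprev,
            forall t : nat, (1 <= t <= T)%N ->
              argmin Z (obj t (grad G zunder + H (mps_zin s k t.-1)))
                (mps_ztilde s k t) /\
              argmin Z (obj t (grad G zunder + H (mps_ztilde s k t)))
                (mps_zin s k t),
            mps_z s k = mps_zin s k T &
            mps_zbar s k = (1 - gamma) *: zbarprev + gamma *: zavg]].

(* Outer iteration k evaluates grad G once, at \underline z_k, and H twice per
   inner iteration, at z_k^{t-1} and \tilde z_k^t. *)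
Definition mps_gradG_evals (N : nat) : nat := (\sum_(1 <= k < N.+1) 1)%N.
Definition mps_H_evals (p : mps_params) (N : nat) : nat :=
  (\sum_(1 <= k < N.+1) 2 * mps_T p k)%N.

(* For L, M > 0 the ceiling is nonnegative, so the absolute value only casts
   it to nat. *)
Definition sliding_T (L M : R) (k : nat) : nat := `|Num.ceil (k%:R * M / L)|%N.

Definition sliding_params (L M : R) : mps_params := {|
  mps_gamma := fun k => 2 / (k%:R + 1);
  mps_beta := fun k => 2 * L / k%:R;
  mps_T := sliding_T L M;
  mps_eta := fun k t =>
    (2 * L / k%:R) * (t%:R - 1) + L * (sliding_T L M k)%:R / k%:R
|}.

End MirrorProxSliding.

(* Main.v *)
Require Import Defs.
From mathcomp Require Import all_boot all_order all_algebra.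
From mathcomp Require Import all_classical all_reals all_analysis.
From mathcomp Require Import ring lra.
Set Implicit Arguments.
Unset Strict Implicit.
Unset Printing Implicit Defensive.
Import Order.TTheory GRing.Theory Num.Theory.
Import numFieldNormedType.Exports.
Local Open Scope classical_set_scope.
Local Open Scope ring_scope.

(** The method runs accelerated gradient descent on [G] in the outer loop and
    the mirror-prox (extragradient) scheme on [H] in the inner loop; each loop
    is analysed by a telescoping sum of Bregman distances.

    Inner loop. Every prox-mapping satisfies a three-point inequality
    ([argmin_prox_le]). Adding the inequalities of the two prox-mappings of an
    inner step, the difference of the two operator values is absorbed by the
    strong convexity of [pi] because [eta_k^t >= M] ([mirror_prox_step]). The
    step sizes satisfy [eta_k^(t+1) = eta_k^t + beta_k], so these estimates
    telescope over [t] ([mirror_prox_loop]), leaving a spare term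
    [beta_k * V(z_(k-1), ztilde_k^t)].

    Outer loop. The descent lemma at [zunder_k] and convexity of [G] bound the
    gap at [zbar_k] by [1 - gamma_k] times the gap at [zbar_(k-1)] plus
    [gamma_k] times the linearized gap at the averaged inner iterate; the error
    [L * gamma_k ^ 2 / 2 * nrm (ztilde_k - z_(k-1)) ^ 2] is covered by the spare
    term because [L * gamma_k <= beta_k] ([outer_step]). Multiplied by
    [k * (k + 1) / 2], this recursion telescopes ([sliding_rate]) and gives

      [Q(zbar_N, z) <= 6 * L * V(z_0, z) / (N * (N + 1))].

    It remains to take [N] as the ceiling of [3 * sqrt (L * Omega / eps)]. Since
    [eps <= L * Omega], this is at most [4 * sqrt (L * Omega / eps)], and
    summing [2 * T_k <= 2 * (k * M / L + 1)] gives the number of evaluations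
    of [H]. *)

(** * The inner product of R^n *)

Section InnerProduct.
Context {R : realType} {n : nat}.
Implicit Types (u v w : 'rV[R]_n).

Lemma innerDl u v w : inner (u + v) w = inner u w + inner v w.
Proof. by rewrite -big_split; apply: eq_bigr => i _; rewrite mxE mulrDl. Qed.

Lemma innerDr u v w : inner w (u + v) = inner w u + inner w v.
Proof. by rewrite -big_split; apply: eq_bigr => i _; rewrite mxE mulrDr. Qed.

Lemma innerZr (a : R) u v : inner u (a *: v) = a * inner u v.
Proof. by rewrite mulr_sumr; apply: eq_bigr => i _; rewrite mxE mulrCA. Qed.

Lemma innerNl u v : inner (- u) v = - inner u v.
Proof. by rewrite -sumrN; apply: eq_bigr => i _; rewrite mxE mulNr. Qed.

Lemma innerNr u v : inner u (- v) = - inner u v.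
Proof. by rewrite -sumrN; apply: eq_bigr => i _; rewrite mxE mulrN. Qed.

Lemma inner0r u : inner u 0 = 0.
Proof. by apply: big1 => i _; rewrite mxE mulr0. Qed.

Definition innerE := (innerDl, innerNl, innerDr, innerNr, innerZr).

Lemma coord_le_norm (x : 'rV[R]_n) i : `|x 0 i| <= `|x|.
Proof.
by rewrite [leRHS]/Num.norm/= mx_normrE; apply: (le_bigmax _ _ (0, i)).
Qed.

Lemma inner_le_norm (u v : 'rV[R]_n) : inner u v <= (\sum_i `|u 0 i|) * `|v|.
Proof.
rewrite mulr_suml; apply: ler_sum => i _.
rewrite (le_trans (ler_norm _))// normrM ler_wpM2l//; exact: coord_le_norm.
Qed.

End InnerProduct.

(** * Arbitrary norms and their duals *)

Section Norms.
Context {R : realType} {n : nat} (nrm : 'rV[R]_n -> R).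
Hypothesis nrmP : is_norm nrm.

Lemma is_norm0 : nrm 0 = 0.
Proof. by case: nrmP => _ hZ _; rewrite -(scale0r 0) hZ normr0 mul0r. Qed.

Lemma is_normN x : nrm (- x) = nrm x.
Proof. by case: nrmP => _ hZ _; rewrite -scaleN1r hZ normrN1 mul1r. Qed.

Lemma is_norm_ge0 x : 0 <= nrm x.
Proof.
case: nrmP => _ _ hD; have := hD x (- x).
by rewrite subrr is_norm0 is_normN -mulr2n pmulrn_lge0.
Qed.

Lemma is_norm_sum (I : Type) (r : seq I) (F : I -> 'rV[R]_n) :
  nrm (\sum_(i <- r) F i) <= \sum_(i <- r) nrm (F i).
Proof.
case: nrmP => _ _ hD.
elim: r => [|i r IH]; first by rewrite !big_nil is_norm0.
by rewrite !big_cons (le_trans (hD _ _))// lerD2l.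
Qed.

(** Expanding [x] in the canonical basis bounds [nrm x] by the sup norm. *)
Lemma is_norm_le_norm : exists K : R, forall x, nrm x <= K * `|x|.
Proof.
case: (nrmP) => _ hZ _.
exists (\sum_(i < n) nrm (delta_mx 0 i)) => x.
rewrite {1}(row_sum_delta x) (le_trans (is_norm_sum _ _))// mulr_suml.
apply: ler_sum => i _; rewrite hZ mulrC ler_wpM2l ?is_norm_ge0//.
exact: coord_le_norm.
Qed.

Lemma is_norm_continuous : continuous nrm.
Proof.
case: (nrmP) => _ _ hD.
have [K hK] := is_norm_le_norm.
have lip x y : `|nrm x - nrm y| <= K * `|x - y|.
  have h1 := hD (x - y) y; have h2 := hD (y - x) x.
  rewrite subrK in h1; rewrite subrK -opprB is_normN in h2.
  have := hK (x - y); rewrite ler_norml; lra.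
move=> x; apply/(@cvgrPdist_lt _ R _ (nbhs x) _ nrm) => e e0.
have K1 : 0 < `|K| + 1 by rewrite ltr_wpDl.
near=> y.
have h : `|x - y| < e / (`|K| + 1).
  near: y; apply/nbhs_ballP; exists (e / (`|K| + 1)) => /=.
      by rewrite divr_gt0.
    by move=> y; rewrite -ball_normE.
rewrite (le_lt_trans (lip _ _))// (@le_lt_trans _ _ ((`|K| + 1) * `|x - y|))//.
  by rewrite ler_wpM2r// (le_trans (ler_norm _))// lerDl.
by rewrite mulrC -ltr_pdivlMr.
Unshelve. all: by end_near.
Qed.

(** The half of the equivalence of norms that needs compactness: [nrm] attains
    a positive minimum on the unit sphere of the sup norm. Without it the
    supremum that defines the dual norm could be that of an unbounded set,
    which is 0 by convention. *)
Lemma norm_le_is_norm : exists2 K : R, 0 < K & forall x, `|x| <= K * nrm x.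
Proof.
case: (nrmP) => h0 hZ _.
pose S := [set x : 'rV[R]_n | `|x| = 1].
(* The unit sphere is empty when the dimension is 0. *)
have [Sne|S0] := pselect (S !=set0); last first.
  exists 1 => // x; have [->|x0] := eqVneq x 0.
    by rewrite normr0 is_norm0 mulr0.
  exfalso; apply: S0; exists (`|x|^-1 *: x).
  by rewrite /S/= normrZ normfV normr_id mulVf ?normr_eq0.
have Scompact : compact S.
  apply: bounded_closed_compact.
    exists 1; split => // M M1 x; rewrite /S/= => ->; exact: ltW.
  have -> : S = (fun x : 'rV[R]_n => `|x|) @^-1` [set 1] by [].
  apply: closed_comp; last exact: closed_eq.
  by move=> x _; exact: norm_continuous.
have [|c cS cmin] := @EVT_min_rV R n nrm S Sne Scompact.
  by apply: continuous_subspaceT; exact: is_norm_continuous.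
rewrite inE/= /S/= in cS.
have c0 : 0 < nrm c.
  rewrite lt_neqAle is_norm_ge0 andbT eq_sym; apply/eqP => /h0 cz.
  by move: cS; rewrite cz normr0 => /esym/eqP; rewrite oner_eq0.
exists (nrm c)^-1; first by rewrite invr_gt0.
move=> x; have [->|x0] := eqVneq x 0; first by rewrite normr0 is_norm0 mulr0.
have := cmin (`|x|^-1 *: x).
rewrite inE /S/= normrZ normfV normr_id mulVf ?normr_eq0// => /(_ erefl).
rewrite hZ normfV normr_id mulrC ler_pdivlMr ?normr_gt0//.
by rewrite ler_pdivlMl.
Qed.

(** The generalized Cauchy-Schwarz inequality, the only property of the dual
    norm that the convergence analysis uses. *)
Lemma inner_le_dual_norm (u v : 'rV[R]_n) : inner u v <= dual_norm nrm u * nrm v.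
Proof.
case: (nrmP) => h0 hZ _.
have [nv0|nv0] := eqVneq (nrm v) 0.
  by rewrite (h0 _ nv0) inner0r is_norm0 mulr0.
have nv : 0 < nrm v by rewrite lt_neqAle eq_sym nv0 is_norm_ge0.
rewrite -ler_pdivrMr// mulrC -innerZr.
apply: sup_ubound; last first.
  exists ((nrm v)^-1 *: v) => //=.
  by rewrite hZ ger0_norm ?invr_ge0 ?is_norm_ge0// mulVf ?lexx.
have [K K0 hK] := norm_le_is_norm.
exists ((\sum_i `|u 0 i|) * K) => _ [x /= x1 <-].
rewrite (le_trans (inner_le_norm _ _))// ler_wpM2l ?sumr_ge0//.
by rewrite (le_trans (hK x))// ler_piMr// ltW.
Qed.

End Norms.

(** * Gradients as directional derivatives *)

Section Gradient.
Context {R : realType} {n : nat}.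
Implicit Types (f : 'rV[R]_n -> R) (x d : 'rV[R]_n).

Lemma derive_grad f x d : differentiable f x -> 'D_d f x = inner (grad f x) d.
Proof.
move=> df; rewrite deriveE// {1}(row_sum_delta d) linear_sum.
by apply: eq_bigr => i _; rewrite linearZ/= mxE deriveE// mulrC.
Qed.

(** A first-order estimate of [f] along the segment from [x] to [x + d] that
    is tight up to [O(t ^ 2)] passes to the limit [t -> 0+] as an estimate of
    the gradient. This one-sided form serves the gradient inequality for
    convex functions, the lower bound on Bregman distances and the optimality
    conditions of prox-mappings, where only points inside [Z] are compared. *)
Lemma grad_le f x d (a b : R) : differentiable f x ->
  (forall t : R, 0 < t -> t <= 1 -> f (t *: d + x) - f x <= t * a + t ^+ 2 * b) ->
  inner (grad f x) d <= a.
Proof.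
move=> df h; rewrite -derive_grad//.
have dx : derivable f x d by exact: diff_derivable.
have hl : (fun t : R => t^-1 *: (f (t *: d + x) - f x) - t * b) @ 0^'+ -->
    'D_d f x - 0 * b.
  apply: cvgB.
    move=> A /dx /nbhs_ballP [_ /posnumP[e] xe_A].
    by exists e%:num => //= y xe_y /gt_eqF/negbT/xe_A; exact.
  by apply: cvgMl; apply: cvg_at_right_filter; exact: cvg_id.
rewrite mul0r subr0 in hl.
apply: (cvgr_to_le hl); near=> t.
have t0 : 0 < t by near: t; exact: nbhs_right_gt.
have t1 : t <= 1 by near: t; exact: nbhs_right_le.
have ht := h t t0 t1.
have : t^-1 * (f (t *: d + x) - f x) <= a + t * b.
  by rewrite ler_pdivrMl// mulrDr mulrA -expr2.
by rewrite -lerBlDr.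
Unshelve. all: by end_near.
Qed.

Lemma grad_ge f x d (a b : R) : differentiable f x ->
  (forall t : R, 0 < t -> t <= 1 -> t * a + t ^+ 2 * b <= f (t *: d + x) - f x) ->
  a <= inner (grad f x) d.
Proof.
move=> df h.
have gN : grad (- f) x = - grad f x.
  by apply/rowP => i; rewrite !mxE deriveN//; exact: diff_derivable.
rewrite -lerN2 -innerNl -gN; apply: (@grad_le (- f) x d (- a) (- b)).
  exact: differentiableN.
move=> t t0 t1; have := h t t0 t1.
rewrite -[(- f) _]/(- f _) -[(- f) x]/(- f x); nra.
Qed.

Lemma is_derive_line f x d (t : R) : differentiable f (t *: d + x) ->
  is_derive t 1 (fun s : R => f (s *: d + x)) (inner (grad f (t *: d + x)) d).
Proof.
move=> df; rewrite -derive_grad//.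
have e : (fun h : R => h^-1 *: (f ((h *: 1 + t) *: d + x) - f (t *: d + x))) =
   (fun h : R => h^-1 *: (f (h *: d + (t *: d + x)) - f (t *: d + x))).
  by apply/funext => h; rewrite addrA -scalerDl -[h *: 1]/(h * 1) mulr1.
have dd : derivable f (t *: d + x) d by exact: diff_derivable.
by split; rewrite /derivable /derive/= e.
Qed.

(** Mean value theorem for [f] along the segment minus its quadratic model
    [t * a + t ^ 2 * b / 2], whose derivative is nonpositive. *)
Lemma smooth_le f x d (a b : R) :
  (forall t : R, 0 <= t -> t <= 1 -> differentiable f (t *: d + x)) ->
  (forall t : R, 0 <= t -> t <= 1 ->
    inner (grad f (t *: d + x)) d <= a + t * b) ->
  f (d + x) <= f x + a + b / 2.
Proof.
move=> df h.
pose phi (t : R) := f (t *: d + x) - (t * a + t ^+ 2 * (b / 2)).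
pose dphi (t : R) := inner (grad f (t *: d + x)) d - (a + t * b).
have hphi (t : R) : 0 <= t -> t <= 1 -> is_derive t 1 phi (dphi t).
  move=> t0 t1; rewrite /phi.
  have h1 := is_derive_line (df t t0 t1).
  apply: is_derive_eq; rewrite /dphi.
  rewrite !scaler0 add0r -[a%:A]/(a * 1) -[(b / 2) *: _]/(b / 2 * _).
  rewrite -[t%:A]/(t * 1); lra.
have [t t01||c] := @MVT_segment R phi dphi 0 1 ler01.
- by apply: hphi; move: t01; rewrite in_itv/= => /andP[/ltW ? /ltW ?].
- apply: derivable_within_continuous => t; rewrite in_itv/= => /andP[t0 t1].
  by have [] := hphi t t0 t1.
rewrite in_itv/= => /andP[c0 c1].
have := h c c0 c1.
rewrite /phi /dphi scale1r scale0r add0r; lra.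
Qed.
End Gradient.

(** * Convexity, smoothness and prox-mappings *)

Section Convexity.
Context {R : realType} {n : nat}.
Implicit Types (Z : set 'rV[R]_n) (f J pi : 'rV[R]_n -> R) (x y d : 'rV[R]_n).

Lemma segmentE (t : R) x y : t *: (x - y) + y = t *: x + (1 - t) *: y.
Proof. by apply/rowP => i; rewrite !mxE; ring. Qed.

Lemma convex_setP Z x y (t : R) : convex_set Z -> Z x -> Z y ->
  0 <= t -> t <= 1 -> Z (t *: x + (1 - t) *: y).
Proof.
move=> cZ Zx Zy t0 t1; have := cZ x y (Itv01 t0 t1).
by rewrite !inE => /(_ Zx Zy).
Qed.

Lemma convex_functionP Z f x y (t : R) : convex_function Z f -> Z x -> Z y ->
  0 <= t -> t <= 1 -> f (t *: x + (1 - t) *: y) <= t * f x + (1 - t) * f y.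
Proof.
move=> cf Zx Zy t0 t1; have := cf (Itv01 t0 t1) x y.
by rewrite !inE => /(_ Zx Zy).
Qed.

(** Jensen's inequality for uniform weights: the mean of [T + 1] points is the
    convex combination, with weight [1 / (T + 1)], of the last point and the
    mean of the others. *)
Lemma average_convex Z f : convex_set Z ->
  (forall x y (t : R), Z x -> Z y -> 0 <= t -> t <= 1 ->
    f (t *: x + (1 - t) *: y) <= t * f x + (1 - t) * f y) ->
  forall (T : nat) (x : nat -> 'rV[R]_n), (0 < T)%N ->
  (forall t, (1 <= t <= T)%N -> Z (x t)) ->
  let avg := T%:R^-1 *: \sum_(1 <= t < T.+1) x t in
  Z avg /\ f avg <= T%:R^-1 * \sum_(1 <= t < T.+1) f (x t).
Proof.
move=> cZ cf; case=> // T x _; elim: T => [|T IH] xZ /=.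
  by rewrite !big_nat1 invr1 scale1r mul1r; split => //; exact: xZ.
have [|Za fa] := IH; first by move=> t /andP[t1 tT]; apply: xZ; rewrite t1 leqW.
rewrite !(big_nat_recr T.+2)//=.
set S := \sum_(1 <= t < T.+2) x t in Za fa *.
set F := \sum_(1 <= t < T.+2) f (x t) in fa *.
set p : R := T.+2%:R^-1.
have T1 : T.+1%:R != 0 :> R by rewrite pnatr_eq0.
have T2 : T.+2%:R != 0 :> R by rewrite pnatr_eq0.
have p0 : 0 <= p by rewrite invr_ge0.
have p1 : p <= 1 by rewrite invf_le1 ?ltr0n// ler1n.
have pE : (1 - p) * T.+1%:R^-1 = p.
  rewrite /p; move: T1 T2; rewrite -(natr1 T.+1).
  by move: (T.+1%:R) => q q0 q1; field; rewrite q0 q1.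
have -> : p *: (S + x T.+2) = p *: x T.+2 + (1 - p) *: (T.+1%:R^-1 *: S).
  by rewrite scalerA pE scalerDr addrC.
have Zx : Z (x T.+2) by apply: xZ; rewrite leqnn.
split; first exact: convex_setP.
rewrite (le_trans (cf _ _ _ Zx Za p0 p1))// mulrDr addrC lerD2r.
by rewrite -[in leRHS]pE -mulrA ler_wpM2l// subr_ge0.
Qed.

Lemma convex_grad_le Z f x y : convex_function Z f -> Z x -> Z y ->
  differentiable f x -> f x + inner (grad f x) (y - x) <= f y.
Proof.
move=> cf Zx Zy df; rewrite -lerBrDl.
apply: (@grad_le _ _ _ _ _ _ 0) => // t t0 t1; rewrite segmentE.
have := convex_functionP cf Zy Zx (ltW t0) t1; lra.
Qed.

(** Subtract the linearization of [pi] from the strong convexity inequality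
    and let the convex combination tend to [x]. *)
Lemma bregman_ge Z nrm pi x y : is_norm nrm -> strongly_convex_on Z nrm 1 pi ->
  Z x -> Z y -> differentiable pi x ->
  nrm (y - x) ^+ 2 / 2 <= bregman pi x y.
Proof.
move=> nrmP cpi Zx Zy dpi; rewrite /bregman.
suff : inner (grad pi x) (y - x) <= pi y - pi x - nrm (y - x) ^+ 2 / 2 by lra.
apply: (@grad_le _ _ _ _ _ _ (nrm (y - x) ^+ 2 / 2)) => // t t0 t1.
rewrite segmentE; have := cpi y x t Zy Zx (ltW t0) t1; lra.
Qed.

(** The descent lemma. The segment stays in [Z], so a Lipschitz gradient on
    [Z] suffices. *)
Lemma lipschitz_grad_le Z nrm (L : R) f x y : is_norm nrm -> convex_set Z ->
  (forall z, Z z -> differentiable f z) -> lipschitz_on_wrt Z nrm L (grad f) ->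
  Z x -> Z y ->
  f y <= f x + inner (grad f x) (y - x) + L / 2 * nrm (y - x) ^+ 2.
Proof.
move=> nrmP cZ df lf Zx Zy.
have Zt (t : R) : 0 <= t -> t <= 1 -> Z (t *: (y - x) + x).
  by move=> t0 t1; rewrite segmentE; exact: convex_setP.
rewrite -{1}(subrK x y).
have -> : L / 2 * nrm (y - x) ^+ 2 = L * nrm (y - x) ^+ 2 / 2 by lra.
apply: smooth_le => t t0 t1; first exact/df/Zt.
have -> : grad f (t *: (y - x) + x) =
  grad f x + (grad f (t *: (y - x) + x) - grad f x) by rewrite [RHS]addrC subrK.
rewrite innerDl lerD2l (le_trans (inner_le_dual_norm nrmP _ _))//.
have := lf _ _ (Zt t t0 t1) Zx; rewrite addrK.
case: (nrmP) => _ hZ _; rewrite hZ ger0_norm// => h.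
have -> : t * (L * nrm (y - x) ^+ 2) = L * (t * nrm (y - x)) * nrm (y - x) by ring.
by rewrite ler_wpM2r ?is_norm_ge0.
Qed.

(** The three-point inequality. At the minimizer [x], the derivative of the
    objective towards [y] is nonnegative, [J] being replaced by its chord. The
    derivative of [bregman pi c] at [x] in the direction [y - x] equals
    [bregman pi c y - bregman pi x y - bregman pi c x]. *)
Lemma argmin_prox_le Z J pi (g : 'rV[R]_n) (beta eta : R) c d x y :
  convex_set Z -> convex_function Z J -> differentiable pi x ->
  0 < beta + eta -> argmin Z (prox_objective J pi g beta eta c d) x -> Z y ->
  inner g (x - y) + J x - J y <=
    beta * (bregman pi c y - bregman pi x y - bregman pi c x) +
    eta * (bregman pi d y - bregman pi x y - bregman pi d x).
Proof.
move=> cZ cJ dpi be0 [Zx xmin] Zy.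
pose a := (beta * inner (grad pi c) (y - x) + eta * inner (grad pi d) (y - x)
  - inner g (y - x) - (J y - J x)).
suff : a / (beta + eta) <= inner (grad pi x) (y - x).
  rewrite ler_pdivrMr// /a /bregman !innerE; lra.
apply: (@grad_ge _ _ _ _ _ _ 0) => // t t0 t1.
rewrite mulr0 addr0 mulrA ler_pdivrMr//.
have Zt : Z (t *: (y - x) + x).
  by rewrite segmentE; exact: convex_setP (ltW t0) t1.
have := xmin _ Zt.
have := convex_functionP cJ Zy Zx (ltW t0) t1.
rewrite -segmentE /prox_objective /bregman /a.
rewrite -!(addrA (t *: (y - x)) x) !(innerDr (t *: (y - x))) !innerZr; lra.
Qed.

End Convexity.

(** * One outer iteration of mirror-prox sliding *)

Section MirrorProxSlidingAnalysis.
Context {R : realType} {n : nat}.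
Variables (Z : set 'rV[R]_n) (nrm : 'rV[R]_n -> R).
Variables (G J pi : 'rV[R]_n -> R) (H : 'rV[R]_n -> 'rV[R]_n) (L M : R).
Hypotheses (nrmP : is_norm nrm) (cZ : convex_set Z).
Hypotheses (cJ : convex_function Z J) (lH : lipschitz_on_wrt Z nrm M H).
Hypotheses (dpi : forall x, Z x -> differentiable pi x)
  (cpi : strongly_convex_on Z nrm 1 pi).

(** One extragradient step. The first prox-mapping is tested against the
    second iterate [z1] and the second against [z]; the mismatch between the
    two operator values, [inner (H zt - H d) (zt - z1)], is of size
    [M * nrm (zt - d) * nrm (zt - z1)] and is absorbed by the strongly convex
    terms [eta * bregman pi d zt] and [eta * bregman pi zt z1] as soon as
    [M <= eta]. The term [beta * bregman pi c zt] is kept on the left: it pays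
    for the smoothness error of [G] in the outer iteration. *)
Lemma mirror_prox_step (g : 'rV[R]_n) (beta eta : R) c d zt z1 z :
  0 <= beta -> 0 < eta -> M <= eta -> Z c -> Z d -> Z z ->
  argmin Z (prox_objective J pi (g + H d) beta eta c d) zt ->
  argmin Z (prox_objective J pi (g + H zt) beta eta c d) z1 ->
  inner (g + H zt) (zt - z) + J zt - J z + beta * bregman pi c zt <=
    beta * bregman pi c z + eta * bregman pi d z
    - (beta + eta) * bregman pi z1 z.
Proof.
move=> b0 e0 Me Zc Zd Zz tmin zmin.
have [Zt _] := tmin; have [Z1 _] := zmin.
have be0 : 0 < beta + eta by lra.
have ht := argmin_prox_le cZ cJ (dpi Zt) be0 tmin Z1.
have hz := argmin_prox_le cZ cJ (dpi Z1) be0 zmin Zz.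
have Vdt := bregman_ge nrmP cpi Zd Zt (dpi Zd).
have Vt1 := bregman_ge nrmP cpi Zt Z1 (dpi Zt).
have cross : inner (H zt - H d) (zt - z1) <=
    eta / 2 * (nrm (zt - d) ^+ 2 + nrm (z1 - zt) ^+ 2).
  have h := lH Zt Zd.
  apply: le_trans (inner_le_dual_norm nrmP _ _) _.
  rewrite -(opprB z1) is_normN//.
  have := is_norm_ge0 nrmP (z1 - zt); have := is_norm_ge0 nrmP (zt - d).
  move: h; move: (nrm (zt - d)) (nrm (z1 - zt)) (dual_norm _ _) => a b m h a0 b0'.
  have : m * b <= eta * a * b.
    by rewrite ler_wpM2r// (le_trans h)// ler_wpM2r.
  have : 0 <= eta * (a - b) ^+ 2 by rewrite mulr_ge0 ?sqr_ge0// ltW.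
  lra.
have e1 : eta * (nrm (zt - d) ^+ 2 / 2) <= eta * bregman pi d zt.
  by rewrite ler_wpM2l// ltW.
have e2 : eta * (nrm (z1 - zt) ^+ 2 / 2) <= eta * bregman pi zt z1.
  by rewrite ler_wpM2l// ltW.
have e3 : 0 <= beta * bregman pi zt z1.
  by rewrite mulr_ge0// (le_trans _ Vt1)// divr_ge0 ?sqr_ge0.
move: ht hz cross; rewrite !innerE; lra.
Qed.

(** With [eta t = beta * (t - 1) + eta1], the coefficient [beta + eta t] of
    the last term of a step is the coefficient [eta t.+1] of the proximal term
    of the next one, so the steps telescope; the anchor [zin 0] collects
    [beta] from each step and [eta1] from the first one. *)
Lemma mirror_prox_loop (g : 'rV[R]_n) (beta eta1 : R) (T : nat)
    (zin zt : nat -> 'rV[R]_n) z :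
  0 <= beta -> 0 < eta1 -> M <= eta1 -> Z (zin 0) -> Z z ->
  (forall t, (1 <= t <= T)%N ->
    let eta := beta * (t%:R - 1) + eta1 in
    argmin Z (prox_objective J pi (g + H (zin t.-1)) beta eta
      (zin 0) (zin t.-1)) (zt t) /\
    argmin Z (prox_objective J pi (g + H (zt t)) beta eta
      (zin 0) (zin t.-1)) (zin t)) ->
  Z (zin T) /\
  \sum_(1 <= t < T.+1) (inner (g + H (zt t)) (zt t - z) + J (zt t) - J z
     + beta * bregman pi (zin 0) (zt t)) <=
  (beta * T%:R + eta1) * (bregman pi (zin 0) z - bregman pi (zin T) z).
Proof.
move=> b0 e0 Me Zc Zz; elim: T => [|T IH] hmin.
  by rewrite big_nil subrr mulr0.
have [|ZT sT] := IH.
  by move=> t /andP[t1 tT]; apply: hmin; rewrite t1 leqW.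
rewrite big_nat_recr//=.
have [|/= hm1 hm2] := hmin T.+1; first by rewrite leqnn.
have [Z1 _] := hm2; split => //.
have bT : 0 <= beta * T%:R by rewrite mulr_ge0.
have eT : T.+1%:R = T%:R + 1 :> R by rewrite natr1.
have e0' : 0 < beta * (T.+1%:R - 1) + eta1 by rewrite eT; lra.
have Me' : M <= beta * (T.+1%:R - 1) + eta1 by rewrite eT; lra.
have := mirror_prox_step b0 e0' Me' Zc ZT Zz hm1 hm2.
rewrite eT; move: sT; lra.
Qed.

Hypotheses (cG : convex_function [set: 'rV[R]_n] G)
  (dG : forall x, differentiable G x) (lG : lipschitz_on_wrt Z nrm L (grad G))
  (mH : monotone_operator H).

(** The accelerated-gradient part. The new point differs from the extrapolated
    point [zu] by [gamma * (a - c)], so the descent lemma at [zu] costs only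
    [L / 2 * gamma ^ 2 * nrm (a - c) ^ 2], and convexity of [G] at [zu] splits
    the linear part between [w] and [z]. *)
Lemma gap_extrapolation_le (gamma beta : R) w c a z :
  0 <= gamma -> gamma <= 1 -> L * gamma <= beta ->
  Z w -> Z c -> Z a ->
  let zu := (1 - gamma) *: w + gamma *: c in
  gap G H J ((1 - gamma) *: w + gamma *: a) z <= (1 - gamma) * gap G H J w z +
    gamma * (inner (grad G zu + H z) (a - z) + J a - J z + beta / 2 * nrm (a - c) ^+ 2).
Proof.
move=> g0 g1 Lgb Zw Zc Za; cbv zeta.
set zu := _ *: w + _ *: c.
have gg : gamma = 1 - (1 - gamma) by ring.
have h0 : 0 <= 1 - gamma by lra.
have h1 : 1 - gamma <= 1 by lra.
have Zu : Z zu by rewrite /zu {2}gg; exact: convex_setP.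
have Zb : Z ((1 - gamma) *: w + gamma *: a) by rewrite {2}gg; exact: convex_setP.
have up := lipschitz_grad_le nrmP cZ (fun x _ => dG x) lG Zu Zb.
have Tt x : [set: 'rV[R]_n] x by [].
have lw := convex_grad_le cG (Tt zu) (Tt w) (dG zu).
have lz := convex_grad_le cG (Tt zu) (Tt z) (dG zu).
have Jb := convex_functionP cJ Zw Za h0 h1.
rewrite -gg in Jb.
have nE : nrm ((1 - gamma) *: w + gamma *: a - zu) = gamma * nrm (a - c).
  case: (nrmP) => _ hZ _; rewrite -(ger0_norm g0) -hZ ger0_norm//; congr (nrm _).
  by apply/rowP => i; rewrite !mxE; ring.
rewrite nE in up.
have sq : L / 2 * (gamma * nrm (a - c)) ^+ 2 <=
    gamma * (beta / 2 * nrm (a - c) ^+ 2).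
  have : 0 <= gamma * nrm (a - c) ^+ 2 by rewrite mulr_ge0 ?sqr_ge0.
  move=> /ler_wpM2r/(_ _ _ Lgb); lra.
have := ler_wpM2l h0 lw; have := ler_wpM2l g0 lz.
move: up Jb sq; rewrite /gap; rewrite !innerE; lra.
Qed.

(** The averaged inner iterate is plugged into [gap_extrapolation_le]; Jensen's
    inequality and the monotonicity of [H] reduce its linearized gap to the
    average of the gaps that [mirror_prox_loop] sums up. *)
Lemma outer_step (gamma beta eta1 : R) (T : nat) w (zin zt : nat -> 'rV[R]_n) :
  0 <= gamma -> gamma <= 1 -> 0 <= beta -> L * gamma <= beta ->
  0 < eta1 -> M <= eta1 -> (0 < T)%N -> Z w -> Z (zin 0) ->
  let g := grad G ((1 - gamma) *: w + gamma *: zin 0%N) in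
  (forall t, (1 <= t <= T)%N ->
    let eta := beta * (t%:R - 1) + eta1 in
    argmin Z (prox_objective J pi (g + H (zin t.-1)) beta eta
      (zin 0) (zin t.-1)) (zt t) /\
    argmin Z (prox_objective J pi (g + H (zt t)) beta eta
      (zin 0) (zin t.-1)) (zin t)) ->
  let zbar := (1 - gamma) *: w +
    gamma *: (T%:R^-1 *: \sum_(1 <= t < T.+1) zt t) in
  [/\ Z (zin T), Z zbar & forall z, Z z ->
  gap G H J zbar z <= (1 - gamma) * gap G H J w z +
    gamma * ((beta + eta1 / T%:R) *
      (bregman pi (zin 0) z - bregman pi (zin T) z))].
Proof.
move=> g0 g1 b0 Lgb e0 Me T0 Zw Zc g hmin zbar.
have Zt t : (1 <= t <= T)%N -> Z (zt t) by move=> /hmin[[]].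
pose a := T%:R^-1 *: \sum_(1 <= t < T.+1) zt t.
pose f z x := inner (g + H z) (x - z) + J x - J z
  + beta / 2 * nrm (x - zin 0) ^+ 2.
(* The linearized gap plus the smoothness error is convex, the square of a
   norm being convex. *)
have cf z x y (t : R) : Z x -> Z y -> 0 <= t -> t <= 1 ->
    f z (t *: x + (1 - t) *: y) <= t * f z x + (1 - t) * f z y.
  move=> Zx Zy t0 t1; have := convex_functionP cJ Zx Zy t0 t1.
  suff : beta / 2 * nrm (t *: x + (1 - t) *: y - zin 0%N) ^+ 2 <=
    beta / 2 * (t * nrm (x - zin 0%N) ^+ 2 + (1 - t) * nrm (y - zin 0%N) ^+ 2).
    by rewrite /f !innerE; lra.
  rewrite ler_wpM2l//; first by rewrite divr_ge0.
  case: (nrmP) => _ hZ hD.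
  have -> : t *: x + (1 - t) *: y - zin 0%N =
     t *: (x - zin 0%N) + (1 - t) *: (y - zin 0%N).
    by apply/rowP => i; rewrite !mxE; ring.
  have := hD (t *: (x - zin 0%N)) ((1 - t) *: (y - zin 0%N)).
  have s0 : 0 <= 1 - t by lra.
  rewrite !hZ !ger0_norm//.
  have := is_norm_ge0 nrmP (t *: (x - zin 0%N) + (1 - t) *: (y - zin 0%N)).
  move: (nrm (_ + _)) (nrm (x - _)) (nrm (y - _)) => p u v p0 pl.
  have : p ^+ 2 <= (t * u + (1 - t) * v) ^+ 2.
    by rewrite !expr2 ler_pM.
  have : 0 <= t * (1 - t) * (u - v) ^+ 2 by rewrite mulr_ge0 ?sqr_ge0// mulr_ge0.
  lra.
have Za : Z a by have [] := average_convex cZ (cf 0) T0 Zt.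
have gg : gamma = 1 - (1 - gamma) by ring.
have h0 : 0 <= 1 - gamma by lra.
have h1 : 1 - gamma <= 1 by lra.
split.
- by have [] := mirror_prox_loop b0 e0 Me Zc Zc hmin.
- by rewrite /zbar {2}gg; exact: convex_setP.
move=> z Zz.
have [_ fa] := average_convex cZ (cf z) T0 Zt.
have [ZT sT] := mirror_prox_loop b0 e0 Me Zc Zz hmin.
apply: le_trans (gap_extrapolation_le _ g0 g1 Lgb Zw Zc Za) _.
rewrite lerD2l ler_wpM2l//; apply: le_trans fa _.
have T1 : 0 < T%:R :> R by rewrite ltr0n.
rewrite ler_pdivrMl// mulrA.
have -> : T%:R * (beta + eta1 / T%:R) = beta * T%:R + eta1.
  by field; rewrite gt_eqF.
apply: le_trans sT; apply: ler_sum_nat => t tT.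
have Vt := bregman_ge nrmP cpi Zc (Zt t tT) (dpi Zc).
have := ler_wpM2l b0 Vt.
have := mH (zt t) z; rewrite /f !innerE; lra.
Qed.

End MirrorProxSlidingAnalysis.

(** * The rate for the sliding parameters, and the complexity bound *)

Section Rate.
Context {R : realType}.

Lemma natr_absz_ceil (x : R) : 0 <= x ->
  x <= (`|Num.ceil x|%N)%:R /\ (`|Num.ceil x|%N)%:R <= x + 1.
Proof.
move=> x0.
have c0 : 0 <= Num.ceil x.
  by rewrite Num.Theory.ceil_ge0 (lt_le_trans _ x0)// ltrN10.
rewrite natr_absz ger0_norm//; split; first exact: Num.Theory.ceil_ge.
by have /ltW := Num.Theory.ceilB1_lt x; rewrite intrB lerBlDr.
Qed.

Lemma sliding_T_bounds (L M : R) k : 0 < L -> 0 < M ->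
  k%:R * M / L <= (sliding_T L M k)%:R /\
  (sliding_T L M k)%:R <= k%:R * M / L + 1.
Proof.
by move=> L0 M0; apply: natr_absz_ceil; rewrite divr_ge0 ?mulr_ge0// ltW.
Qed.

(** With [gamma = 2 / (k + 1)] one has
    [k * (k + 1) / 2 * (1 - gamma) = (k - 1) * k / 2], so the weighted gaps
    telescope. The choice of [eta] makes [beta + eta1 / T = 3 * L / k], hence
    the weight of the Bregman terms is the constant [3 * L]. *)
Lemma sliding_rate (n : nat) (Z : set 'rV[R]_n) (nrm : 'rV[R]_n -> R)
    (G J pi : 'rV[R]_n -> R) (H : 'rV[R]_n -> 'rV[R]_n) (L M : R) z0 N s :
  is_norm nrm -> convex_set Z -> convex_function Z J ->
  lipschitz_on_wrt Z nrm M H -> (forall x, Z x -> differentiable pi x) ->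
  strongly_convex_on Z nrm 1 pi -> convex_function [set: 'rV[R]_n] G ->
  (forall x, differentiable G x) -> lipschitz_on_wrt Z nrm L (grad G) ->
  monotone_operator H -> 0 < L -> 0 < M -> Z z0 ->
  mps_run Z G H J pi z0 (sliding_params L M) N s ->
  forall k, (k <= N)%N -> [/\ Z (mps_z s k), Z (mps_zbar s k) &
    forall z, Z z -> k%:R * (k%:R + 1) / 2 * gap G H J (mps_zbar s k) z <=
      3 * L * (bregman pi z0 z - bregman pi (mps_z s k) z)].
Proof.
move=> nrmP cZ cJ lH dpi cpi cG dG lG mH L0 M0 Zz0 [s0 sb0 srun].
elim=> [|k IH] kN.
  by rewrite s0 sb0; split => // z Zz; rewrite !mul0r subrr mulr0.
have [Zk Zbk hk] := IH (ltnW kN).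
have /= [h0 hmin hz hzb] := srun k.+1 kN.
rewrite -h0 in Zk hmin hk hzb.
set T := sliding_T L M k.+1 in hmin hz hzb.
have [TM _] := sliding_T_bounds k.+1 L0 M0; rewrite -/T in TM.
have q0 : 0 <= k%:R :> R by [].
have q1 : 0 < k.+1%:R :> R by rewrite ltr0n.
have T1 : 0 < T%:R :> R by rewrite (lt_le_trans _ TM)// divr_gt0// mulr_gt0.
have T0 : (0 < T)%N by rewrite -(ltr0n R).
set gamma : R := 2 / (k.+1%:R + 1) in hmin hzb.
set beta : R := 2 * L / k.+1%:R in hmin.
set eta1 : R := L * T%:R / k.+1%:R in hmin.
have g0 : 0 <= gamma by rewrite divr_ge0// addr_ge0.
have g1 : gamma <= 1 by rewrite ler_pdivrMr ?mul1r -?natr1; lra.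
have b0 : 0 <= beta by rewrite divr_ge0// mulr_ge0// ltW.
have Lgb : L * gamma <= beta.
  rewrite /gamma /beta mulrA (mulrC L) ler_pM2l ?mulr_gt0//.
  by rewrite lef_pV2 ?posrE ?lerDl// addr_gt0.
have e0 : 0 < eta1 by rewrite divr_gt0// mulr_gt0.
have Me : M <= eta1.
  rewrite /eta1 ler_pdivlMr// (mulrC L) -ler_pdivrMr//.
  by rewrite (mulrC M).
have [ZT Zb hgap] := outer_step nrmP cZ cJ lH dpi cpi cG dG lG mH
  g0 g1 b0 Lgb e0 Me T0 Zbk Zk hmin.
rewrite hz hzb; split=> // z Zz.
have q2 : 0 <= k.+1%:R * (k.+1%:R + 1) / 2 :> R.
  by rewrite divr_ge0// mulr_ge0// addr_ge0.
have e1 : k.+1%:R * (k.+1%:R + 1) / 2 * (1 - gamma) = k%:R * (k%:R + 1) / 2.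
  by rewrite /gamma -natr1; field; lra.
have e2 : k.+1%:R * (k.+1%:R + 1) / 2 * (gamma * (beta + eta1 / T%:R)) = 3 * L.
  rewrite /gamma /beta /eta1; move: T1 q1; move: (T%:R) (k.+1%:R) => t q t0 q0'.
  by field; lra.
have hk1 := ler_wpM2l q2 (hgap z Zz).
have rearr (K u A v B D : R) :
  K * (u * A + v * (B * D)) = K * u * A + K * (v * B) * D by ring.
rewrite rearr e1 e2 in hk1.
by have := hk z Zz; lra.
Qed.

End Rate.

Theorem corollary2p4 (R : realType) :
  exists C : R, 0 < C /\
  forall (n : nat) (Z : set 'rV[R]_n) (nrm : 'rV[R]_n -> R)
    (G : 'rV[R]_n -> R) (H : 'rV[R]_n -> 'rV[R]_n) (J : 'rV[R]_n -> R)
    (pi : 'rV[R]_n -> R) (L M : R) (z0 : 'rV[R]_n),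
    Z !=set0 -> compact Z -> convex_set Z ->
    is_norm nrm ->
    0 < L -> 0 < M ->
    convex_function [set: 'rV[R]_n] G ->
    continuously_differentiable_on [set: 'rV[R]_n] G ->
    lipschitz_on_wrt Z nrm L (grad G) ->
    monotone_operator H ->
    lipschitz_on_wrt Z nrm M H ->
    convex_function Z J ->
    simple Z J pi ->
    (exists U : set 'rV[R]_n,
      [/\ open U, Z `<=` U & continuously_differentiable_on U pi]) ->
    strongly_convex_on Z nrm 1 pi ->
    Z z0 ->
    forall eps : R, 0 < eps -> eps <= L * Omega Z pi z0 ->
    exists N : nat,
      [/\ (1 <= N)%N,
          (forall s : mps_iterates,
             mps_run Z G H J pi z0 (sliding_params L M) N s ->
             (ereal_sup [set (gap G H J (mps_zbar s N) z)%:E | z in Z]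
                <= eps%:E)%E),
          (mps_gradG_evals N)%:R <= C * Num.sqrt (L * Omega Z pi z0 / eps) &
          (mps_H_evals (sliding_params L M) N)%:R <=
            C * (M * Omega Z pi z0 / eps
                 + Num.sqrt (L * Omega Z pi z0 / eps))].
Proof.
exists 32; split => // n Z nrm G H J pi L M z0 _ _ cZ nrmP L0 M0 cG dG lG mH lH
  cJ _ [U [_ ZU dU]] cpi Zz0 eps eps0 epsL.
have Om0 : 0 < Omega Z pi z0.
  by rewrite -(pmulr_rgt0 _ L0) (lt_le_trans eps0).
(* A positive real supremum is that of a nonempty bounded set. *)
have supV : has_sup [set bregman pi z0 z | z in Z].
  by apply: contrapT => /sup_out Om; move: Om0; rewrite /Omega Om ltxx.
have VOm z : Z z -> bregman pi z0 z <= Omega Z pi z0.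
  by move=> Zz; apply: sup_ubound; [case: supV | exists z].
have dpi x : Z x -> differentiable pi x by move=> /ZU/dU[].
have dG' x : differentiable G x by have [] := dG x.
set x := L * Omega Z pi z0 / eps.
have x1 : 1 <= x by rewrite ler_pdivlMr// mul1r.
have r1 : 1 <= Num.sqrt x by rewrite -sqrtr1 ler_wsqrtr.
have xE : x = Num.sqrt x ^+ 2 by rewrite sqr_sqrtr// (le_trans _ x1).
(* N iterations give the gap 6 * L * Omega / (N * (N + 1)), and 6 <= 3 ^ 2;
   the ceiling costs at most one more, so that N <= 4 * sqrt x as 1 <= x. *)
have [N1 N2] := natr_absz_ceil (mulr_ge0 (ler0n R 3) (sqrtr_ge0 x)).
set N := `|_|%N in N1 N2.
have MOm : M * Omega Z pi z0 / eps = M / L * Num.sqrt x ^+ 2.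
  by rewrite -xE /x; field; rewrite !gt_eqF.
move: xE MOm r1 N1 N2; set r := Num.sqrt x => xE MOm r1 N1 N2.
have N0 : (0 < N)%N by rewrite -(ltr0n R); lra.
exists N; split => //.
- move=> s srun; apply: ge_ereal_sup => _ [z Zz <-]; rewrite lee_fin.
  have [ZN ZbN /(_ z Zz)] := sliding_rate nrmP cZ cJ lH dpi cpi cG dG' lG mH
    L0 M0 Zz0 srun (leqnn N).
  have VN := bregman_ge nrmP cpi ZN Zz (dpi _ ZN).
  have V0 : 0 <= bregman pi (mps_z s N) z.
    by rewrite (le_trans _ VN)// divr_ge0 ?sqr_ge0.
  have LOm : L * Omega Z pi z0 = eps * r ^+ 2.
    by rewrite -xE /x; field; rewrite gt_eqF.
  have h : 3 * L * (bregman pi z0 z - bregman pi (mps_z s N) z) <=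
     3 * (eps * r ^+ 2).
    rewrite -LOm -mulrA ler_pM2l// ler_pM2l//; have := VOm z Zz; lra.
  move=> /le_trans/(_ h) => hh.
  have K0 : 0 < N%:R * (N%:R + 1) / 2 :> R.
    by rewrite divr_gt0// mulr_gt0// ?addr_gt0// ltr0n.
  rewrite -(ler_pM2l K0) (le_trans hh)//.
  rewrite -[3 * _]mulrCA mulrC ler_pM2r//.
  nra.
- rewrite /mps_gradG_evals sum_nat_const_nat subn1/= muln1; lra.
- rewrite /mps_H_evals natr_sum MOm.
  have ML : 0 < M / L by rewrite divr_gt0.
  (* Each T_k is at most N * M / L + 1, for a total of
     2 * N ^ 2 * M / L + 2 * N, and 2 * 4 ^ 2 = 32. *)
  apply: (@le_trans _ _ (\sum_(1 <= k < N.+1) 2 * (N%:R * (M / L) + 1))).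
    apply: ler_sum_nat => k /andP[_ kN]; rewrite natrM ler_pM2l//=.
    have [_ hT] := sliding_T_bounds k L0 M0; rewrite (le_trans hT)// lerD2r.
    by rewrite -mulrA ler_pM2r// ler_nat.
  rewrite sumr_const_nat subn1/= -mulr_natr.
  have : (M / L) * N%:R ^+ 2 <= M / L * (4 * r) ^+ 2.
    rewrite ler_pM2l// !expr2 ler_pM//; lra.
  lra.
Qed.
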